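(* Let $f:\mathbb{R}^d\to\mathbb{R}$ be differentiable with a global minimizer $w_*$, and assume that $f$ is $L$-smooth ($L>0$) and $(\rho,\mu)$-strongly quasar convex with respect to $w_*$, where $\rho>0$ and $\mu>0$. Consider the discrete-time algorithm with parameters $$\tau_k=\frac1{1+\rho}\left(1-\exp\left(-(1+\rho)\sqrt{\tfrac\mu L}(T_{k+1}-T_k)\right)\right),\qquad \tau'_k=\frac{\rho\left(1-\exp\left(-(1+\rho)\sqrt{\tfrac\mu L}(T_{k+1}-T_k)\right)\right)}{\rho+\exp\left(-(1+\rho)\sqrt{\tfrac\mu L}(T_{k+1}-T_k)\right)},$$ $\tilde\gamma_k=\frac1L$ and $\tilde\gamma'_k=\frac1{\sqrt{\mu L}}$. Then for every $k\ge1$, every $c\in(0,1)$ and every $c_0>1$, with probability at least $1-\frac1{c^2k}-\frac1{c_0}$, $$f(\tilde w_k)-f(w_* )\le c_0\left(f(\tilde w_0)-f(w_* )+\frac\mu2\|\tilde z_0-w_*\|^2\right)\exp\left(-\rho\sqrt{\frac\mu L}(1-c)k\right).$$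
   Context: Norms and inner products on $\mathbb{R}^d$ are Euclidean. $f$ is $L$-smooth if $f(x)\le f(y)+\langle\nabla f(y),x-y\rangle+\frac L2\|x-y\|^2$ for all $x,y\in\mathbb{R}^d$. $f$ is $(\rho,\mu)$-strongly quasar convex with respect to the global minimizer $w_*$ if $f(w_* )\ge f(w)+\frac1\rho\langle\nabla f(w),w_*-w\rangle+\frac\mu2\|w_*-w\|^2$ for all $w\in\mathbb{R}^d$. Random times: $T_0=0<T_1<T_2<\cdots$, where the increments $T_1,T_2-T_1,T_3-T_2,\dots$ are i.i.d. exponential random variables with mean $1$. Probability is with respect to these random times. Discrete-time algorithm: given (possibly random) parameters and deterministic initial points $\tilde w_0,\tilde z_0\in\mathbb{R}^d$, for $k=0,1,2,\dots$: $$\tilde v_k=\tilde w_k+\tau_k(\tilde z_k-\tilde w_k),\quad \tilde w_{k+1}=\tilde v_k-\tilde\gamma_{k+1}\nabla f(\tilde v_k),\quad \tilde z_{k+1}=\tilde z_k+\tau'_k(\tilde v_k-\tilde z_k)-\tilde\gamma'_{k+1}\nabla f(\tilde v_k).$$ *)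

(* Defs.v *)
From HB Require Import structures.
From mathcomp Require Import all_boot all_order all_algebra.
From mathcomp Require Import all_classical all_reals all_analysis.
From mathcomp Require Import measurable_realfun.

Set Implicit Arguments.
Unset Strict Implicit.
Unset Printing Implicit Defensive.

Import Order.TTheory GRing.Theory Num.Theory.
Import numFieldNormedType.Exports.

Local Open Scope classical_set_scope.
Local Open Scope ring_scope.

Section Euclidean.
Context {R : realType} {d : nat}.
Implicit Types (x y w : 'rV[R]_d) (f : 'rV[R]_d -> R).

Definition dotp x y : R := \sum_(i < d) x 0 i * y 0 i.

(* The library norm `|x| on 'rV[R]_d is the sup norm.  It induces the same
   topology as [enorm], hence the same notion of differentiability. *)
Definition enorm x : R := Num.sqrt (dotp x x).

(* Meaningful where f is differentiable: the derivative operator 'D is total. *)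
Definition gradient f x : 'rV[R]_d := \row_(i < d) 'D_(delta_mx 0 i) f x.

Definition global_minimizer f w := forall x, f w <= f x.

Definition smooth (L : R) f := forall x y,
  f x <= f y + dotp (gradient f y) (x - y) + L / 2 * enorm (x - y) ^+ 2.

Definition strongly_quasar_convex (rho mu : R) f wstar := forall w,
  f w + rho^-1 * dotp (gradient f w) (wstar - w)
      + mu / 2 * enorm (wstar - w) ^+ 2 <= f wstar.

(* gamma and gamma' are used from index 1 on, tau and tau' from index 0 on. *)
Definition algorithm f (tau tau' gamma gamma' : nat -> R)
    (v w z : nat -> 'rV[R]_d) := forall k,
  [/\ v k = w k + tau k *: (z k - w k),
      w k.+1 = v k - gamma k.+1 *: gradient f (v k)
    & z k.+1 = z k + tau' k *: (v k - z k) - gamma' k.+1 *: gradient f (v k)].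

End Euclidean.

Section RandomTimes.
Context {R : realType} {dO : measure_display} {Omega : measurableType dO}.
Context (P : probability Omega R).

Definition mutually_independent (X : nat -> Omega -> R) :=
  forall (s : seq nat) (B : nat -> set R),
    uniq s -> (forall i, measurable (B i)) ->
    P (\bigcap_(i in [set` s]) X i @^-1` B i)
    = (\prod_(i <- s) P (X i @^-1` B i))%E.

Definition increment (T : nat -> {RV P >-> R}) (k : nat) : {RV P >-> R} :=
  (T k.+1 : {mfun Omega >-> R}) - T k.

(* [exponential_prob] is parameterized by the rate, the inverse of the mean.
   Laws are compared on Borel sets only: outside the sigma-algebra the value of
   a measure is arbitrary. *)
Definition exponential_times (T : nat -> {RV P >-> R}) :=
  [/\ forall omega, T 0%N omega = 0,
      forall k omega, T k omega < T k.+1 omega,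
      mutually_independent (increment T)
    & forall k (B : set R), measurable B ->
        distribution P (increment T k) B = exponential_prob 1 B].

(* The measurability clause makes P E a genuine probability. *)
Definition with_probability_at_least (p : R) (E : set Omega) :=
  measurable E /\ (p%:E <= P E)%E.

End RandomTimes.

(* Main.v *)
Require Import Defs.
From HB Require Import structures.
From mathcomp Require Import all_boot all_order all_algebra.
From mathcomp Require Import all_classical all_reals all_analysis.
From mathcomp Require Import measurable_realfun ring lra.
Import Order.TTheory GRing.Theory Num.Theory.
Import numFieldNormedType.Exports.
Local Open Scope classical_set_scope.
Local Open Scope ring_scope.

(** Writing theta = sqrt (mu / L), the algorithm is the sampling, at the times
    T_k, of a continuous-time process: between two jumps the pair (w, z) follows
    the linear flow w' = theta (z - w), z' = rho theta (w - z), and at each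
    arrival of a Poisson process of rate 1 both components take a gradient step.
    The coefficients tau_k and tau'_k are those of the closed-form solution of
    the flow over the waiting time T_(k+1) - T_k ([flow_wE], [flow_zE]).

    Let Phi (w, z) = f w - f wstar + mu/2 |z - wstar|^2 and a = rho theta.  The
    infinitesimal generator of the process, applied to exp (a t) Phi, is
    nonpositive: this is the pointwise inequality [energy_dissipation], where
    smoothness pays for the jump and strong quasar convexity for the drift.
    Integrated against the exponential law of a waiting time it gives
    [one_step_energy_le]: one flow-and-jump step does not increase the mean of
    exp (a t) Phi.  As the k-th waiting time is independent of the state reached
    at time T_k ([past_independent], turned by Fubini-Tonelli into
    [integral_next_le]), the expectation of exp (a T_k) Phi (w_k, z_k) is at
    most Phi (w_0, z_0) for every k ([expected_energy_le]), and the Markov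
    inequality bounds exp (a T_k) Phi (w_k, z_k) by c0 Phi (w_0, z_0) outside an
    event of probability at most 1 / c0.

    There remains to replace the random T_k by (1 - c) k.  The same one-step
    argument applied to (1 + c)^k exp (- c T_k) bounds the Laplace transform of
    T_k, hence, by the Markov inequality again, the probability of
    T_k < (1 - c) k by exp (- c^2 k / 2), which is at most 1 / (c^2 k)
    ([arrival_time_lower_tail]).

    Measurability needs gradient f to be continuous.  The one-sided smoothness
    inequality already forces this: it sandwiches each partial derivative
    between difference quotients of f ([gradient_continuous]). *)

Set Implicit Arguments.
Unset Strict Implicit.
Unset Printing Implicit Defensive.

(** * Euclidean inner product and gradient *)

Section InnerProduct.
Context {R : realType} {d : nat}.
Implicit Types (x y z : 'rV[R]_d) (a : R).

Lemma dotpC x y : dotp x y = dotp y x.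
Proof. by apply: eq_bigr => i _; rewrite mulrC. Qed.

Lemma dotpDl x y z : dotp (x + y) z = dotp x z + dotp y z.
Proof. by rewrite -big_split; apply: eq_bigr => i _; rewrite mxE mulrDl. Qed.

Lemma dotpZl a x y : dotp (a *: x) y = a * dotp x y.
Proof. by rewrite mulr_sumr; apply: eq_bigr => i _; rewrite mxE mulrA. Qed.

Lemma dotpNl x y : dotp (- x) y = - dotp x y.
Proof. by rewrite -scaleN1r dotpZl mulN1r. Qed.

Lemma dotpDr x y z : dotp z (x + y) = dotp z x + dotp z y.
Proof. by rewrite dotpC dotpDl !(dotpC _ z). Qed.

Lemma dotpZr a x y : dotp y (a *: x) = a * dotp y x.
Proof. by rewrite dotpC dotpZl (dotpC _ y). Qed.

Lemma dotpNr x y : dotp y (- x) = - dotp y x.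
Proof. by rewrite dotpC dotpNl (dotpC _ y). Qed.

Definition dotpE := (dotpDl, dotpDr, dotpZl, dotpZr, dotpNl, dotpNr).

Lemma dotp_ge0 x : 0 <= dotp x x.
Proof. by apply: sumr_ge0 => i _; rewrite -expr2 sqr_ge0. Qed.

Lemma enorm_sq x : enorm x ^+ 2 = dotp x x.
Proof. by rewrite /enorm sqr_sqrtr// dotp_ge0. Qed.

Lemma dotp_delta x (i : 'I_d) : dotp x (delta_mx 0 i) = x 0 i.
Proof.
rewrite /dotp (bigD1 i)//= big1 ?addr0 ?mxE ?eqxx ?mulr1// => j ji.
by rewrite mxE eqxx (negbTE ji) mulr0.
Qed.

End InnerProduct.

(** Here p, q and p', q' stand for the increments of a function from two points
    x and y along h and - h, and gx, gy for its slopes at these points.  The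
    upper bounds on p' and q' pinch gy between the two difference quotients. *)
Lemma slope_sandwich (R : realFieldType) (L h eps gx gy p q p' q' : R) :
  0 < h -> L * h < eps / 2 ->
  `|gx - h^-1 * p| < eps / 4 -> `|gx - (- h)^-1 * q| < eps / 4 ->
  `|p - p'| < h * (eps / 4) -> `|q - q'| < h * (eps / 4) ->
  p' <= h * gy + L / 2 * h ^+ 2 -> q' <= - h * gy + L / 2 * (- h) ^+ 2 ->
  `|gx - gy| < eps.
Proof.
move=> h0; rewrite invrN sqrrN mulNr opprK.
have hp : h * (h^-1 * p) = p by rewrite mulVKf// gt_eqF.
have hq : h * (h^-1 * q) = q by rewrite mulVKf// gt_eqF.
move: (h^-1 * p) (h^-1 * q) hp hq => u w <- <-.
rewrite !ltr_norml => Lh /andP[_ u_gx] /andP[gx_w _].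
move=> /andP[_ uB] /andP[_ wB] pB qB.
have LhE : L / 2 * h ^+ 2 = h * (L * h) / 2 by field.
have := ltr_pM2l h0 (L * h) (eps / 2); rewrite Lh mulrA => Lhh.
by apply/andP; split; rewrite -(ltr_pM2l h0); nra.
Qed.

Section Gradient.
Context {R : realType} {d : nat}.
Implicit Types (f : 'rV[R]_d -> R) (x v : 'rV[R]_d) (L : R).

Lemma diff_gradient f x v : differentiable f x ->
  'd f x v = dotp (gradient f x) v.
Proof.
move=> fx; rewrite {1}[v]row_sum_delta linear_sum; apply: eq_bigr => i _.
by rewrite linearZ /gradient mxE deriveE// mulrC.
Qed.

Lemma is_derive_comp_gradient f (u : R -> 'rV[R]_d) (t : R) (u' : 'rV[R]_d) :
  differentiable f (u t) -> is_derive t 1 u u' ->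
  is_derive t 1 (f \o u) (dotp (gradient f (u t)) u').
Proof.
move=> fx [du <-].
have dU : differentiable u t by exact/derivable1_diffP.
apply: DeriveDef; first by apply/derivable1_diffP; exact: differentiable_comp.
rewrite deriveE; last exact: differentiable_comp.
by rewrite diff_comp//= diff_gradient// -deriveE.
Qed.

(** Near x, the quotients (f (y + h e_i) - f y) / h with h of a fixed small size
    are continuous in y and close to the partial derivative at x, while
    smoothness at y, used with steps h and - h, bounds the partial derivative at
    y on both sides by these quotients up to L |h| / 2. *)
Lemma gradient_continuous L f : smooth L f -> (forall x, differentiable f x) ->
  forall i, continuous (fun x => gradient f x 0 i).
Proof.
move=> fL df i x; set e := delta_mx 0 i : 'rV[R]_d.
have fstep (y : 'rV[R]_d) (s : R) :
    f (y + s *: e) <= f y + s * gradient f y 0 i + L / 2 * s ^+ 2.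
  have := fL (y + s *: e) y; rewrite (addrAC y) subrr add0r enorm_sq !dotpE.
  have -> : dotp e e = 1 by rewrite dotp_delta mxE !eqxx.
  by rewrite dotp_delta mulr1 -expr2.
have qcvg : s^-1 * (f (x + s *: e) - f x) @[s --> 0^'] --> gradient f x 0 i.
  rewrite mxE -/e; have dfx : derivable f x e by exact: diff_derivable.
  apply: cvg_trans dfx; apply: near_eq_cvg; near=> s.
  by rewrite /= [x + _]addrC.
apply/(@cvgrPdist_lt _ _ _ (nbhs x) (nbhs_filter x)) => eps eps0.
have [h [h0 hL qh qNh]] : exists h : R, [/\ 0 < h, L * h < eps / 2,
    `|gradient f x 0 i - h^-1 * (f (x + h *: e) - f x)| < eps / 4
  & `|gradient f x 0 i - (- h)^-1 * (f (x + - h *: e) - f x)| < eps / 4].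
  have /cvgrPdist_lt/(_ (eps / 4))[|r/= r0 qr] := qcvg; first by lra.
  pose h := Num.min (r / 2) (eps / 4 / (`|L| + 1)).
  have L1 : 0 < `|L| + 1 by rewrite ltr_wpDl.
  have h0 : 0 < h by rewrite lt_min !divr_gt0//.
  exists h; split => //.
  - have : h * (`|L| + 1) <= eps / 4 by rewrite -ler_pdivlMr// ge_min lexx orbT.
    have := ler_norm L; nra.
  - apply: qr; last by rewrite gt_eqF.
    rewrite /ball_/= sub0r normrN gtr0_norm// /h.
    by rewrite gt_min; apply/orP; left; lra.
  - apply: qr; last by rewrite oppr_eq0 gt_eqF.
    rewrite /ball_/= sub0r opprK gtr0_norm// /h.
    by rewrite gt_min; apply/orP; left; lra.
have shiftf s : f (y + s *: e) - f y @[y --> x] --> f (x + s *: e) - f x.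
  have fc y : {for y, continuous f} by exact: differentiable_continuous.
  apply: (@cvgB _ _ _ (nbhs x) (nbhs_filter x)); last exact: fc.
  apply: (@cvg_comp _ _ _ (fun y => y + s *: e) f _ _ _ _ (fc _)).
  apply: (@cvgD _ _ _ (nbhs x) (nbhs_filter x)); first exact: cvg_id.
  exact: cvg_cst.
have e4 : 0 < h * (eps / 4) by rewrite mulr_gt0// divr_gt0.
have /(@cvgrPdist_lt _ _ _ (nbhs x) (nbhs_filter x))/(_ _ e4) near1 := shiftf h.
have /(@cvgrPdist_lt _ _ _ (nbhs x) (nbhs_filter x))/(_ _ e4) near2 :=
  shiftf (- h).
near=> y.
have : `|f (x + h *: e) - f x - (f (y + h *: e) - f y)| < h * (eps / 4).
  by near: y.
have : `|f (x + - h *: e) - f x - (f (y + - h *: e) - f y)| < h * (eps / 4).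
  by near: y.
have := fstep y h; have := fstep y (- h).
move=> c1 c2 d1 d2; have := slope_sandwich h0 hL qh qNh d2 d1; apply.
- by rewrite lerBlDl addrA.
- by rewrite lerBlDl addrA.
Unshelve. all: by end_near. Qed.
End Gradient.

(** * Integrals, independence and tail bounds *)

(** J is dominated, after weighting by the exponential density, by the decrease
    rate - h of a nonnegative function H, so its integral is at most the total
    decrease of H on the half-line, hence at most H 0.  The bound is asked for
    all real s, including negative ones, so that H is monotone on the whole line
    and has a limit at infinity. *)
Lemma exponential_integral_le {R : realType} (H h J : R -> R) :
  (forall s : R, is_derive s 1 H (h s)) -> continuous h ->
  (forall s, 0 <= H s) -> measurable_fun [set: R] J ->
  (forall s, 0 <= J s) -> (forall s, J s * expR (- s) <= - h s) ->
  (\int[lebesgue_measure]_s (J s * exponential_pdf 1 s)%:E <= (H 0)%:E)%E.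
Proof.
move=> dH ch H0 mJ J0 Jh.
have h_le0 s : h s <= 0.
  by rewrite -oppr_ge0 (le_trans _ (Jh s))// mulr_ge0// expR_ge0.
have derH (s : R) : derivable H s 1 by have [] := dH s.
have cH : continuous H.
  by move=> s; apply/differentiable_continuous/derivable1_diffP.
have H'E (s : R) : (H^`())%classic s = h s by rewrite derive1E; case: (dH s).
have H_nincr : {homo H : x y /~ x <= y}.
  move=> y x xy; apply: (@ler0_derive1_nincr _ H x y) => //.
    by move=> s _; rewrite H'E.
  exact: continuous_subspaceT.
have [l l0 Hl] : exists2 l : R, 0 <= l & H s @[s --> +oo] --> l.
  have /nonincreasing_cvge : {homo EFin \o H : x y / x <= y >-> (y <= x)%E}.
    by move=> x y xy; rewrite /= lee_fin H_nincr.
  set i := ereal_inf _.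
  have i_ge0 : (0 <= i)%E.
    by apply: le_ereal_inf_tmp => _ [s _ <-]; rewrite lee_fin.
  have i_le : (i <= (H 0)%:E)%E by apply: ereal_inf_lbound; exists 0.
  have i_fin : i \is a fin_num.
    by rewrite ge0_fin_numE// (le_lt_trans i_le)// ltry.
  move=> Hi; exists (fine i); first by rewrite fine_ge0.
  by move: Hi; rewrite -{1}(fineK i_fin) => /fine_cvgP[].
apply: (@le_trans _ _ (\int[lebesgue_measure]_(s in `[0%R, +oo[) (- h s)%:E)%E).
  rewrite [leRHS]integral_mkcond; apply: ge0_le_integral => //.
  - by move=> s _; rewrite lee_fin mulr_ge0// exponential_pdf_ge0.
  - apply/measurable_EFinP/measurable_funM => //.
    exact: measurable_exponential_pdf.
  - apply: (measurable_restrictT _ _).1 => //; apply/measurable_EFinP.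
    apply/measurable_funTS/measurableT_comp => //.
    exact: continuous_measurable_fun.
  - move=> s _; rewrite /exponential_pdf /patch; case: ifPn => _.
      by rewrite lee_fin mul1r mulN1r.
    by rewrite mulr0.
rewrite (@ge0_continuous_FTC2y _ _ (fun s => - H s) 0 (- l)).
- by rewrite -EFinN opprK -EFinD lee_fin gerDr oppr_le0.
- by move=> s _; rewrite oppr_ge0.
- by apply: continuous_subspaceT => s; apply: cvgN; exact: ch.
- exact: cvgN.
- by move=> s _; apply: derivableN.
- by apply: cvgN; apply: cvg_at_right_filter; exact: cH.
- by move=> s _; rewrite derive1E deriveN// -derive1E H'E.
Qed.

(** The Radon-Nikodym derivative of nu with respect to m has the same integrals
    as p over all measurable sets, so it equals p almost everywhere. *)
Lemma integral_density {d} {T : measurableType d} {R : realType}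
    (nu : {finite_measure set T -> \bar R})
    (m : {sigma_finite_measure set T -> \bar R}) (p : T -> R)
    (g : T -> \bar R) :
  measurable_fun [set: T] p ->
  (forall A, measurable A -> nu A = \int[m]_(x in A) (p x)%:E)%E ->
  measurable_fun [set: T] g -> (forall x, 0 <= g x)%E ->
  (\int[nu]_x g x = \int[m]_x (g x * (p x)%:E))%E.
Proof.
move=> mp nuE mg g0.
have nu_m : nu `<< m.
  apply/null_content_dominatesP => A mA mA0; rewrite nuE//.
  by apply: null_set_integral => //; exact/measurable_EFinP/measurable_funTS.
rewrite -(Radon_Nikodym_SigmaFinite.change_of_variables nu_m)//.
have fi := Radon_Nikodym_SigmaFinite.f_integrable nu_m.
apply: ae_eq_integral => //.
- by apply: emeasurable_funM => //; exact: measurable_int fi.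
- by apply: emeasurable_funM => //; exact/measurable_EFinP.
- apply: ae_eqe_mul2l; apply: integral_ae_eq => //.
    exact/measurable_EFinP.
  move=> E _ mE; rewrite -nuE//.
  by rewrite -Radon_Nikodym_SigmaFinite.f_integral.
Qed.

Section IndependentPair.
Context {dO d1 d2} {Omega : measurableType dO} {T1 : measurableType d1}
  {T2 : measurableType d2} {R : realType} (P : probability Omega R).
Context (Y : {mfun Omega >-> T1}) (X : {mfun Omega >-> T2}).
Hypothesis indep : forall A B, measurable A -> measurable B ->
  (P (Y @^-1` A `&` X @^-1` B) = P (Y @^-1` A) * P (X @^-1` B))%E.

(** Independence says that the joint law of (Y, X) agrees with the product of
    the two laws on rectangles; the two measures are therefore equal, and the
    formula is Tonelli's theorem. *)
Lemma integral_independent_pair (g : T1 * T2 -> \bar R) :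
  measurable_fun [set: T1 * T2] g -> (forall t, 0 <= g t)%E ->
  (\int[P]_omega g (Y omega, X omega) =
   \int[distribution P Y]_y \int[distribution P X]_x g (y, x))%E.
Proof.
move=> mg g0.
have mYX : measurable_fun [set: Omega] (fun omega => (Y omega, X omega)).
  exact: measurable_fun_pair.
pose YX : {mfun Omega >-> (T1 * T2)%type} :=
  HB.pack (fun omega => (Y omega, X omega))
    (isMeasurableFun.Build _ _ _ _ _ mYX).
have jointE : forall A, measurable A ->
    ((distribution P Y \x distribution P X) A = distribution P YX A)%E.
  apply: product_measure_unique => A B mA mB.
  exact: indep.
rewrite -(fubini_tonelli1 (m1 := distribution P Y) (m2 := distribution P X))//.
rewrite (eq_measure_integral (distribution P YX)) ?ge0_integral_distribution//.
by move=> A mA _; exact: jointE.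
Qed.

End IndependentPair.

Lemma measurable_ltr_set {dT} {T : measurableType dT} {R : realType}
    (g h : T -> R) :
  measurable_fun [set: T] g -> measurable_fun [set: T] h ->
  measurable [set t | g t < h t].
Proof.
move=> mg mh; have := measurable_fun_ltr mg mh measurableT (Y := [set true]).
by rewrite setTI; apply.
Qed.

(** For b = 0 the threshold is 0 and the usual inequality is void; the integral
    then vanishes and g is almost surely zero. *)
Lemma markov_bound {dO} {Omega : measurableType dO} {R : realType}
    (P : probability Omega R) (g : Omega -> R) (b C : R) :
  measurable_fun [set: Omega] g -> (forall omega, 0 <= g omega) ->
  0 <= b -> 0 < C -> (\int[P]_omega (g omega)%:E <= b%:E)%E ->
  (P [set omega | (C * b < g omega)%R] <= (C^-1)%:E)%E.
Proof.
move=> mg g0 b0 C0 gb.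
have mE : measurable_fun [set: Omega] (EFin \o g) by exact/measurable_EFinP.
have absE : (\int[P]_omega `|(g omega)%:E| = \int[P]_omega (g omega)%:E)%E.
  by apply: eq_integral => omega _; rewrite gee0_abs// lee_fin.
have mgt : measurable [set omega | C * b < g omega].
  exact: measurable_ltr_set.
have [b_gt0|] := ltP 0 b; last first.
  move=> b_le0; have {b0 b_le0} bE : b = 0 by apply/eqP; rewrite eq_le b0 b_le0.
  have /(ae_eq_integral_abs P measurableT mE) g_ae0 :
      (\int[P]_omega `|(EFin \o g) omega| = 0)%E.
    apply/eqP; rewrite eq_le integral_ge0 ?andbT//.
    by rewrite absE (le_trans gb)// bE.
  rewrite (_ : P _ = 0%E) ?lee_fin ?invr_ge0 ?ltW//.
  apply/negligibleP => //; apply: negligibleS g_ae0 => omega /=.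
  by rewrite bE mulr0 => g_gt0 /(_ I)[g_eq0]; rewrite g_eq0 ltxx in g_gt0.
have Cb0 : 0 < C * b by rewrite mulr_gt0.
have mge : measurable
    [set omega | ((C * b)%:E <= `|(EFin \o g) omega|)%E].
  rewrite -[X in measurable X]setTI; apply: emeasurable_fun_c_infty => //.
  exact: measurableT_comp.
have := le_integral_abse P measurableT mE Cb0.
rewrite setTI absE => /le_trans/(_ gb) Pb.
have {}Pb : ((C * b)%:E * P [set omega | (C * b < g omega)%R] <= b%:E)%E.
  apply: le_trans Pb; rewrite lee_pmul2l ?lte_fin//.
  apply: le_measure; rewrite ?inE//.
  by move=> omega /= /ltW; rewrite lee_fin ger0_norm.
rewrite -(@lee_pmul2l _ (C * b)%:E) ?lte_fin// -EFinM mulrAC.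
by rewrite divff ?gt_eqF// mul1r.
Qed.

(** * Measurability of vector-valued maps *)

Section CoordinateMeasurability.
Context {d0} {T : measurableType d0} {R : realType} {d : nat}.
Implicit Types (u v : T -> 'rV[R]_d) (a : T -> R).

(** Measurability of a map into 'rV[R]_d for the Borel sigma-algebra, in a form
    that refers only to real-valued functions. *)
Definition coord_measurable u :=
  forall i, measurable_fun [set: T] (fun t => u t 0 i).

(** O is the countable union of the cubes with rational centre and radius
    1 / (n + 1) that it contains. *)
Lemma measurable_preimage_open u (O : set 'rV[R]_d) :
  coord_measurable u -> open O -> measurable (u @^-1` O).
Proof.
move=> mu oO.
pose B (rn : 'rV[rat]_d * nat) := [set y : 'rV[R]_d |
  forall i, `|ratr (rn.1 0 i) - y 0 i| < rn.2.+1%:R^-1].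
have -> : u @^-1` O = \bigcup_(rn in [set rn | B rn `<=` O]) (u @^-1` B rn).
  apply/seteqP; split => [t /= Out|t [rn /= + Bu]]; last by apply.
  have /nbhs_ballP[e /= e0 eO] : nbhs (u t) O by exact: open_nbhs_nbhs.
  have [n ne] : exists n, n.+1%:R^-1 < e / 2.
    have /ltr_add_invr[n] : 0 < e / 2 by rewrite divr_gt0.
    by rewrite add0r; exists n.
  have rE i : exists r : rat, `|ratr r - u t 0 i| < n.+1%:R^-1.
    have n0 : 0 < n.+1%:R^-1 :> R by rewrite invr_gt0.
    have [] := @dense_rat R (ball (u t 0 i) n.+1%:R^-1).
    - by exists (u t 0 i); exact: ballxx.
    - exact: ball_open.
    - by move=> x [/= + [r _ rx]]; rewrite /ball/= distrC -rx; exists r.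
  have [r rP] := choice rE.
  exists (\row_i r i, n) => /=; last by move=> i /=; rewrite mxE.
  move=> y By; apply: eO; split => // i j; rewrite ord1 /ball/=.
  have := By j; rewrite /= mxE => yr.
  rewrite -(subrKA (ratr (r j))) (le_lt_trans (ler_normD _ _))//.
  by rewrite [ltRHS]splitr ltrD// (lt_trans _ ne)// distrC.
rewrite bigcup_mkcond; apply: countable_bigcupT_measurable.
  exact: countableP.
move=> rn; case: ifP => // _.
rewrite (_ : _ @^-1` _ = \bigcap_(i in [set: 'I_d])
  [set t | `|ratr (rn.1 0 i) - u t 0 i| < rn.2.+1%:R^-1]); last first.
  by apply/seteqP; split=> [t /= Bt i _|t Bt i]; apply: Bt.
apply: fin_bigcap_measurable => // i _.
apply: measurable_ltr_set => //.
by apply: measurableT_comp => //; exact: measurable_funB.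
Qed.

Lemma measurable_continuous_comp u (h : 'rV[R]_d -> R) :
  coord_measurable u -> continuous h -> measurable_fun [set: T] (h \o u).
Proof.
move=> mu ch; apply: (measurability _ (RGenOpens.measurableE R)).
move=> _ [_ [a [b ->] <-]]; rewrite setTI.
rewrite comp_preimage; apply: measurable_preimage_open => //.
by apply: open_comp => // x _; exact: ch.
Qed.

Lemma measurable_dotp u v : coord_measurable u -> coord_measurable v ->
  measurable_fun [set: T] (fun t => dotp (u t) (v t)).
Proof.
by move=> mu mv; apply: measurable_sum => i; exact: measurable_funM.
Qed.

Lemma coord_measurableD u v : coord_measurable u -> coord_measurable v ->
  coord_measurable (fun t => u t + v t).
Proof.
move=> mu mv i; rewrite (_ : (fun t => _) = (fun t => u t 0 i + v t 0 i)).
  exact: measurable_funD.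
by apply/funext => t; rewrite mxE.
Qed.

Lemma coord_measurableZ a u : measurable_fun [set: T] a ->
  coord_measurable u -> coord_measurable (fun t => a t *: u t).
Proof.
move=> ma mu i; rewrite (_ : (fun t => _) = (fun t => a t * u t 0 i)).
  exact: measurable_funM.
by apply/funext => t; rewrite mxE.
Qed.

Lemma coord_measurable_cst (x : 'rV[R]_d) : coord_measurable (fun=> x).
Proof. by move=> i; exact: measurable_cst. Qed.

Lemma coord_measurableB u v : coord_measurable u -> coord_measurable v ->
  coord_measurable (fun t => u t - v t).
Proof.
move=> mu mv; apply: coord_measurableD => // i.
rewrite (_ : (fun t => _) = (fun t => - v t 0 i)); last first.
  by apply/funext => t; rewrite mxE.
exact: measurableT_comp.
Qed.

End CoordinateMeasurability.

(** * Derivatives along lines *)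

Lemma is_derive_continuous {R : realType} {V : normedModType R}
    (u u' : R -> V) :
  (forall s : R, is_derive s 1 u (u' s)) -> continuous u.
Proof.
move=> du s; apply/differentiable_continuous/derivable1_diffP.
by have [] := du s.
Qed.

Lemma is_derive_congr {R : numFieldType} {V W : normedModType R}
    (f g : V -> W) (x v : V) (f' g' : W) :
  is_derive x v f f' -> f =1 g -> f' = g' -> is_derive x v g g'.
Proof. by move=> df /funext <- <-. Qed.

Lemma is_derive_expRM {R : realType} (k s : R) :
  is_derive s 1 (fun t => expR (k * t)) (k * expR (k * s)).
Proof.
have dk : is_derive s 1 (fun t => k * t) k.
  by apply: is_derive_eq; rewrite scaler1.
by rewrite mulrC; exact: (@is_derive1_comp _ expR _ s _ _ _ dk).
Qed.

Section Lines.
Context {R : realType} {d : nat}.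
Implicit Types (x v : 'rV[R]_d) (u : R -> R) (s : R).

Lemma is_derive_line u x v s (u' : R) : is_derive s 1 u u' ->
  is_derive s 1 (fun t => x + u t *: v) (u' *: v).
Proof.
move=> [du <-]; have dfu : differentiable u s by exact/derivable1_diffP.
rewrite -[X in is_derive _ _ _ X]add0r; apply: is_deriveD.
have duv : differentiable (fun t => u t *: v) s by exact: differentiableZl.
apply: DeriveDef; first exact/derivable1_diffP.
by rewrite deriveE// diffZl// -deriveE.
Qed.

Lemma is_derive_dotp_line u x v s (u' : R) : is_derive s 1 u u' ->
  is_derive s 1 (fun t => dotp (x + u t *: v) (x + u t *: v))
    (2 * dotp (u' *: v) (x + u s *: v)).
Proof.
move=> du.
have dc := @is_derive_cst R R R.
apply: (is_derive_congr (is_deriveD (dc (dotp x x) s 1) (is_deriveD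
  (is_deriveM (dc (2 * dotp x v) s 1) du)
  (is_deriveM (dc (dotp v v) s 1) (is_deriveM du du))))).
  by move=> t; rewrite !fctE !dotpE (dotpC v x); ring.
by rewrite !fctE !dotpE (dotpC v x) /GRing.scale/=; ring.
Qed.

End Lines.

(** * The flow, the jumps and the energy *)

Definition energy {R : realType} {d : nat} (f : 'rV[R]_d -> R)
    (wstar : 'rV[R]_d) (mu : R) (x z : 'rV[R]_d) : R :=
  f x - f wstar + mu / 2 * dotp (z - wstar) (z - wstar).

Section Flow.
Context {R : realType} {d : nat} (f : 'rV[R]_d -> R) (wstar : 'rV[R]_d).
Context (L rho mu : R) (L_gt0 : 0 < L) (rho_gt0 : 0 < rho) (mu_gt0 : 0 < mu).
Hypothesis f_diff : forall x : 'rV[R]_d, differentiable f x.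
Hypothesis f_min : global_minimizer f wstar.
Hypothesis f_smooth : smooth L f.
Hypothesis f_sqc : strongly_quasar_convex rho mu f wstar.
Implicit Types (x z w : 'rV[R]_d) (s : R).

Let theta := Num.sqrt (mu / L).
Local Notation Phi := (energy f wstar mu).

Let theta_gt0 : 0 < theta. Proof. by rewrite sqrtr_gt0 divr_gt0. Qed.

Let theta_sq : theta ^+ 2 = mu / L.
Proof. by rewrite sqr_sqrtr// divr_ge0// ltW. Qed.

Let momentumE : 1 / Num.sqrt (mu * L) = theta / mu.
Proof.
have -> : mu * L = (mu / L) * L ^+ 2 by field; rewrite gt_eqF.
rewrite sqrtrM ?divr_ge0 ?ltW// sqrtr_sqr gtr0_norm// -/theta.
have -> : mu = theta ^+ 2 * L by rewrite theta_sq divfK// gt_eqF.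
by field; rewrite !gt_eqF.
Qed.

Lemma energy_ge0 x z : 0 <= Phi x z.
Proof.
apply: addr_ge0; first by rewrite subr_ge0 f_min.
by rewrite mulr_ge0 ?dotp_ge0// divr_ge0// ltW.
Qed.

Lemma gap_le_energy x z : f x - f wstar <= Phi x z.
Proof. by rewrite lerDl mulr_ge0 ?dotp_ge0// divr_ge0// ltW. Qed.

Definition jump_w x := x - (1 / L) *: gradient f x.
Definition jump_z x z := z - (1 / Num.sqrt (mu * L)) *: gradient f x.

(** The left-hand side collects the terms of the generator of the jump process
    applied to exp (rho theta t) Phi: the growth of the exponential, the
    derivatives of f w and of mu/2 |z - wstar|^2 along the flow, and the energy
    after the jump.  Smoothness bounds f (jump_w x) by
    f x - |gradient f x|^2 / (2 L), which cancels the quadratic term created by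
    the jump of z because mu / 2 * (1 / sqrt (mu L))^2 = 1 / (2 L).  The
    remaining gradient term is theta times the inner product of gradient f x and
    wstar - x, controlled by strong quasar convexity, and the squared distances
    left over add up to a nonpositive multiple of |x - z|^2. *)
Lemma energy_dissipation x z :
  rho * theta * Phi x z + theta * dotp (gradient f x) (z - x)
    + mu * (rho * theta) * dotp (x - z) (z - wstar)
    + Phi (jump_w x) (jump_z x z) <= Phi x z.
Proof.
have := f_smooth (jump_w x) x; have := f_sqc x.
rewrite /jump_w (addrAC x) subrr add0r !enorm_sq /Phi /energy /jump_z momentumE.
set g := gradient f x; set fx' := f (x - _).
have -> : z - (theta / mu) *: g - wstar = (z - wstar) - (theta / mu) *: g.
  by rewrite addrAC.
have -> : wstar - x = - (x - wstar) by rewrite opprB.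
have -> : z - x = (z - wstar) - (x - wstar).
  by rewrite opprB addrA subrK.
have -> : x - z = (x - wstar) - (z - wstar).
  by rewrite opprB addrA subrK.
move: (x - wstar) (z - wstar) => X Z; rewrite !dotpE (dotpC Z g).
have := dotp_ge0 (X - Z); rewrite !dotpE (dotpC Z X).
move: (dotp g X) (dotp g Z) (dotp g g) (dotp X X) (dotp X Z) (dotp Z Z) (f x).
move=> gX gZ gg XX XZ ZZ fx cs qc sm.
have quad : mu / 2 * (ZZ - theta / mu * gZ
      + (- (theta / mu * gZ) - theta / mu * - (theta / mu * gg)))
    = mu / 2 * ZZ - theta * gZ + gg / (2 * L).
  have -> : gg / (2 * L) = mu / 2 * (theta ^+ 2 / mu ^+ 2) * gg.
    by rewrite theta_sq; field; rewrite !gt_eqF.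
  by field; rewrite gt_eqF.
have {}sm : fx' <= fx - gg / (2 * L).
  apply: le_trans sm _; rewrite le_eqVlt; apply/orP; left; apply/eqP.
  by field; rewrite gt_eqF.
have {}qc : rho * (fx - f wstar + mu / 2 * XX) <= gX.
  have := ler_wpM2l (ltW rho_gt0) qc.
  have -> : rho * (fx + rho^-1 * - gX + mu / 2 * - - XX)
      = rho * (fx + mu / 2 * XX) - gX.
    by field; rewrite gt_eqF.
  by move=> *; lra.
have {}qc := ler_wpM2l (ltW theta_gt0) qc.
have {}cs := ler_wpM2l
  (mulr_ge0 (mulr_ge0 (ltW mu_gt0) (ltW rho_gt0)) (ltW theta_gt0)) cs.
rewrite quad; lra.
Qed.

(** Along the flow the gap u = z - w solves u' = - (1 + rho) theta u, hence is
    multiplied by this factor ([flow_gap]), while rho w + z is conserved. *)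
Definition relaxation s := expR (- (1 + rho) * theta * s).

Definition flow_w s x z :=
  x + (1 / (1 + rho) * (1 - relaxation s)) *: (z - x).

Definition flow_z s x z :=
  z + (rho / (1 + rho) * (1 - relaxation s)) *: (x - z).

Let rho1_neq0 : 1 + rho != 0. Proof. by rewrite gt_eqF// addr_gt0. Qed.

Lemma flow_gap s x z : flow_z s x z - flow_w s x z = relaxation s *: (z - x).
Proof.
rewrite /flow_w /flow_z; move: (relaxation s) => E.
by apply/rowP => i; rewrite !mxE; field.
Qed.

Lemma is_derive_flow_w s x z :
  is_derive s 1 (fun t => flow_w t x z)
    (theta *: (flow_z s x z - flow_w s x z)).
Proof.
rewrite flow_gap scalerA; apply: is_derive_line.
have dE := is_derive_expRM (- (1 + rho) * theta) s.
rewrite (_ : (fun t => _) = cst (1 / (1 + rho)) * (cst 1 - relaxation)).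
  by apply: is_derive_eq; rewrite /relaxation /GRing.scale/=; field.
by [].
Qed.

Lemma is_derive_sqdist_flow_z s x z :
  is_derive s 1
    (fun t => dotp (flow_z t x z - wstar) (flow_z t x z - wstar))
    (2 * (rho * theta)
       * dotp (flow_w s x z - flow_z s x z) (flow_z s x z - wstar)).
Proof.
have -> : flow_w s x z - flow_z s x z = relaxation s *: (x - z).
  by rewrite -opprB flow_gap -scalerN opprB.
have dE := is_derive_expRM (- (1 + rho) * theta) s.
have du : is_derive s 1 (fun t => rho / (1 + rho) * (1 - relaxation t))
    (rho * theta * relaxation s).
  rewrite (_ : (fun t => _) = cst (rho / (1 + rho)) * (cst 1 - relaxation))//.
  by apply: is_derive_eq; rewrite /relaxation /GRing.scale/=; field.
have := is_derive_dotp_line (z - wstar) (x - z) du.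
rewrite -scalerA dotpZl mulrA.
congr (is_derive _ _ _ _); last by rewrite (addrAC z).
by apply/funext => t; rewrite /flow_z (addrAC z).
Qed.

(** The exponent is rho theta - 1 and not rho theta: the factor exp (- s) is the
    density of the waiting time, that is the probability that no jump has
    occurred before s. *)
Definition discounted_energy x z s :=
  expR ((rho * theta - 1) * s) * Phi (flow_w s x z) (flow_z s x z).

Definition discounted_energy' x z s :=
  expR ((rho * theta - 1) * s) *
  ((rho * theta - 1) * Phi (flow_w s x z) (flow_z s x z)
   + theta * dotp (gradient f (flow_w s x z)) (flow_z s x z - flow_w s x z)
   + mu * (rho * theta)
       * dotp (flow_w s x z - flow_z s x z) (flow_z s x z - wstar)).

Lemma is_derive_discounted_energy x z s :
  is_derive s 1 (discounted_energy x z) (discounted_energy' x z s).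
Proof.
have dE := is_derive_expRM (rho * theta - 1) s.
have df := is_derive_comp_gradient (f_diff _) (is_derive_flow_w s x z).
have dz := is_derive_sqdist_flow_z s x z.
have dc := @is_derive_cst R R R.
apply: (is_derive_congr (is_deriveM dE (is_deriveD
  (is_deriveB df (dc (f wstar) s 1)) (is_deriveM (dc (mu / 2) s 1) dz)))) => //.
rewrite /discounted_energy' /energy !fctE /GRing.scale/= dotpZr.
by field.
Qed.

Definition step_w s x z := jump_w (flow_w s x z).
Definition step_z s x z := jump_z (flow_w s x z) (flow_z s x z).

Lemma flow_wE s x z (t : R) (v : 'rV[R]_d) :
  t = 1 / (1 + rho) * (1 - relaxation s) -> v = x + t *: (z - x) ->
  v = flow_w s x z.
Proof. by move=> -> ->. Qed.

(** The coefficient tau' is relative to v - z, where v has already moved along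
    the flow; this is the origin of its denominator. *)
Lemma flow_zE s x z (t' : R) :
  t' = rho * (1 - relaxation s) / (rho + relaxation s) ->
  z + t' *: (flow_w s x z - z) = flow_z s x z.
Proof.
move=> ->; rewrite /flow_w /flow_z.
have : rho + relaxation s != 0 by rewrite gt_eqF// addr_gt0// expR_gt0.
move: (relaxation s) => E E_neq0.
by apply/rowP => i; rewrite !mxE; field; rewrite rho1_neq0 E_neq0.
Qed.

Lemma discounted_energy'_continuous x z : continuous (discounted_energy' x z).
Proof.
have cH : continuous (discounted_energy x z).
  exact: is_derive_continuous (is_derive_discounted_energy x z).
have cE k : continuous (fun s => expR (k * s)).
  exact: is_derive_continuous (is_derive_expRM k).
have cw : continuous (fun s => flow_w s x z).
  exact: is_derive_continuous (fun s => is_derive_flow_w s x z).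
have cgrad : continuous
    (fun s => dotp (gradient f (flow_w s x z)) (z - x)).
  move=> s; apply: cvg_big => [|i _]; first exact: add_continuous.
  apply: cvgM; last exact: cvg_cst.
  apply: (@continuous_comp _ _ _ (fun s => flow_w s x z)
    (fun y => gradient f y 0 i)); first exact: cw.
  exact: gradient_continuous f_smooth f_diff i _.
pose E s := expR ((rho * theta - 1) * s).
pose G s := dotp (gradient f (flow_w s x z)) (z - x).
pose D s := dotp (z - x) (z - wstar)
  - rho / (1 + rho) * (1 - relaxation s) * dotp (z - x) (z - x).
rewrite (_ : discounted_energy' x z =
  (fun s => (rho * theta - 1) * discounted_energy x z s
    + E s * (theta * (relaxation s * G s)
             - mu * (rho * theta) * (relaxation s * D s)))).
  have cD : continuous D.
    move=> s; apply: cvgB; first exact: cvg_cst.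
    apply: cvgM; last exact: cvg_cst.
    by apply: cvgM; [exact: cvg_cst|apply: cvgB; [exact: cvg_cst|exact: cE]].
  move=> s; apply: cvgD; first by apply: cvgM; [exact: cvg_cst|exact: cH].
  apply: cvgM; first exact: cE.
  apply: cvgB; (apply: cvgM; first exact: cvg_cst).
    by apply: cvgM; [exact: cE|exact: cgrad].
  by apply: cvgM; [exact: cE|exact: cD].
apply/funext => s.
have DE : dotp (z - x) (flow_z s x z - wstar) = D s.
  by rewrite /flow_z (addrAC z) dotpDr -(opprB z x) scalerN dotpNr dotpZr.
rewrite /discounted_energy' -(opprB (flow_z s x z)) flow_gap dotpNl !dotpZl.
rewrite dotpZr DE -/(G s) /discounted_energy -/(E s); ring.
Qed.

Section StepMeasurability.
Context {dT} {T : measurableType dT} (a : T -> R) (x z : T -> 'rV[R]_d).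
Hypotheses (ma : measurable_fun [set: T] a)
  (mx : coord_measurable x) (mz : coord_measurable z).

Let mrel : measurable_fun [set: T] (fun t => 1 - relaxation (a t)).
Proof.
apply: measurable_funB => //; rewrite /relaxation.
by apply: (measurableT_comp (f := expR)) => //; exact: measurable_funM.
Qed.

Let mflow_w : coord_measurable (fun t => flow_w (a t) (x t) (z t)).
Proof.
apply: coord_measurableD => //; apply: coord_measurableZ.
  exact: measurable_funM.
exact: coord_measurableB.
Qed.

Let mflow_z : coord_measurable (fun t => flow_z (a t) (x t) (z t)).
Proof.
apply: coord_measurableD => //; apply: coord_measurableZ.
  exact: measurable_funM.
exact: coord_measurableB.
Qed.

Let mgrad : coord_measurable (fun t => gradient f (flow_w (a t) (x t) (z t))).
Proof.
move=> i; apply: (measurable_continuous_comp mflow_w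
  (h := fun y => gradient f y 0 i)).
exact: gradient_continuous.
Qed.

Lemma coord_measurable_step_w :
  coord_measurable (fun t => step_w (a t) (x t) (z t)).
Proof. by apply: coord_measurableB => //; exact: coord_measurableZ. Qed.

Lemma coord_measurable_step_z :
  coord_measurable (fun t => step_z (a t) (x t) (z t)).
Proof. by apply: coord_measurableB => //; exact: coord_measurableZ. Qed.

Lemma measurable_objective : measurable_fun [set: T] (fun t => f (x t)).
Proof.
by apply: measurable_continuous_comp => // y; exact: differentiable_continuous.
Qed.

Lemma measurable_energy : measurable_fun [set: T] (fun t => Phi (x t) (z t)).
Proof.
apply: measurable_funD.
  by apply: measurable_funB => //; exact: measurable_objective.
apply: measurable_funM => //; apply: measurable_dotp;
  by apply: coord_measurableB => //; exact: coord_measurable_cst.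
Qed.

End StepMeasurability.

(** By [energy_dissipation], the energy after a jump at time s, multiplied by
    exp (rho theta s) and by the density exp (- s), is at most the decrease rate
    of [discounted_energy] at s. *)
Lemma one_step_energy_le x z :
  (\int[lebesgue_measure]_s (expR (rho * theta * s)
      * Phi (step_w s x z) (step_z s x z) * exponential_pdf 1 s)%:E
    <= (Phi x z)%:E)%E.
Proof.
have -> : Phi x z = discounted_energy x z 0.
  rewrite /discounted_energy /flow_w /flow_z /relaxation !mulr0 expR0 subrr.
  by rewrite !mulr0 !scale0r !addr0 mul1r.
apply: (@exponential_integral_le R (discounted_energy x z)
  (discounted_energy' x z)
  (fun s => expR (rho * theta * s) * Phi (step_w s x z) (step_z s x z))).
- exact: is_derive_discounted_energy.
- exact: discounted_energy'_continuous.
- by move=> s; rewrite mulr_ge0 ?expR_ge0 ?energy_ge0.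
- apply: measurable_funM.
    by apply: measurableT_comp => //; exact: measurable_funM.
  by apply: measurable_energy; [apply: coord_measurable_step_w|
    apply: coord_measurable_step_z] => //; exact: coord_measurable_cst.
- by move=> s; rewrite mulr_ge0 ?expR_ge0 ?energy_ge0.
- move=> s; rewrite mulrAC -expRD.
  have -> : rho * theta * s - s = (rho * theta - 1) * s by ring.
  rewrite /discounted_energy' -mulrN ler_pM2l ?expR_gt0//.
  have := energy_dissipation (flow_w s x z) (flow_z s x z).
  rewrite /step_w /step_z; lra.
Qed.

End Flow.

(** * The past of a sequence of independent variables *)

Section Past.
Context {R : realType} {dO} {Omega : measurableType dO}.
Context (P : probability Omega R) (X : nat -> {RV P >-> R}).
Hypothesis X_indep : mutually_independent P (fun i => X i).

(** The events given by separate conditions on X_0, ..., X_(k-1): a family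
    stable under intersection, on which mutual independence can be read off
    directly, and which generates the sigma-algebra of the past. *)
Definition cylinders k : set (set Omega) :=
  [set A | exists2 B : nat -> set R, forall i, measurable (B i)
    & A = \bigcap_(i in `I_k) X i @^-1` B i].

(** Omega itself with a coarser sigma-algebra, so that the state reached after k
    steps is a measurable function on [past k] and the pair formed by the
    outcome in [past k] and X_k has a product law. *)
Definition past k := g_sigma_algebraType (cylinders k).

Lemma cylinders_measurable k : cylinders k `<=` measurable.
Proof.
move=> _ [B mB ->]; apply: fin_bigcap_measurable; first exact: finite_II.
by move=> i _; exact: measurable_funPTI.
Qed.

Lemma past_measurable k : <<s cylinders k >> `<=` measurable.
Proof.
apply: smallest_sub; last exact: cylinders_measurable.
exact: sigma_algebra_measurable.
Qed.

Lemma cylinders_mono k : cylinders k `<=` cylinders k.+1.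
Proof.
move=> _ [B mB ->]; exists (fun i => if (i < k)%N then B i else setT).
  by move=> i; case: ifP.
apply/seteqP; split => omega Bomega i /= ik.
  by case: ifP => // ik'; exact: Bomega.
by have := Bomega i; rewrite /= ik ltnS (ltnW ik); exact.
Qed.

Lemma past_mono k : <<s cylinders k >> `<=` <<s cylinders k.+1 >>.
Proof. by apply: sub_sigma_algebra2; exact: cylinders_mono. Qed.

Lemma measurable_past_next k d' (T' : measurableType d') (h : Omega -> T') :
  measurable_fun [set: past k] h -> measurable_fun [set: past k.+1] h.
Proof. by move=> mh _ A mA; apply: past_mono; exact: mh. Qed.

Lemma measurable_past_X k : measurable_fun [set: past k.+1] (X k).
Proof.
move=> _ A mA; rewrite setTI; apply: sub_sigma_algebra.
exists (fun i => if i == k then A else setT); first by move=> i; case: ifP.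
apply/seteqP; split => omega /=.
  by move=> Xomega i _ /=; case: eqP => // ->.
by move/(_ k); rewrite /= ltnSn eqxx; exact.
Qed.

Lemma measurable_past_forget k d' (T' : measurableType d') (h : Omega -> T') :
  measurable_fun [set: past k] h -> measurable_fun [set: Omega] h.
Proof. by move=> mh _ A mA; apply: (@past_measurable k); exact: mh. Qed.

(** For fixed B both sides are finite measures in A which agree on cylinders. *)
Lemma past_independent k A B : <<s cylinders k >> A -> measurable B ->
  (P (A `&` X k @^-1` B) = P A * P (X k @^-1` B))%E.
Proof.
move=> pA mB; have mXB : measurable (X k @^-1` B).
  exact: measurable_funPTI.
have PB_ge0 : 0 <= fine (P (X k @^-1` B)) by exact: fine_ge0.
rewrite muleC -[P (X k @^-1` B)]fineK ?fin_num_measure//.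
apply: (g_sigma_algebra_measure_unique (cylinders k)
  (@cylinders_measurable k) (fun=> setT) _ _
  (mrestr P mXB) (mscale (NngNum PB_ge0) P)) => //.
- move=> _; exists (fun=> setT) => //.
  by apply/seteqP; split.
- by apply/seteqP; split => // omega _; exists 0%N.
- move=> _ _ [B1 mB1 ->] [B2 mB2 ->].
  exists (fun i => B1 i `&` B2 i); first by move=> i; exact: measurableI.
  by rewrite -bigcapI.
- move=> _ [C mC ->]; rewrite /= /mscale/= fineK ?fin_num_measure//.
  pose C' i := if i == k then B else C i.
  have mC' i : measurable (C' i) by rewrite /C'; case: ifP.
  have iotaE n : [set` iota 0 n] = `I_n.
    by apply/seteqP; split => i /=; rewrite mem_iota.
  have C'E i : i \in iota 0 k -> C' i = C i.
    by rewrite mem_iota /C'/= => ik; rewrite lt_eqF.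
  have cylE n (D : nat -> set R) : (forall i, measurable (D i)) ->
      P (\bigcap_(i in `I_n) X i @^-1` D i)
      = (\prod_(i <- iota 0 n) P (X i @^-1` D i))%E.
    by move=> mD; rewrite -iotaE; exact: X_indep (iota_uniq 0 n) mD.
  rewrite -[LHS]/(P (\bigcap_(i in `I_k) X i @^-1` C i `&` X k @^-1` B)).
  have -> : \bigcap_(i in `I_k) X i @^-1` C i `&` X k @^-1` B
      = \bigcap_(i in `I_k.+1) X i @^-1` C' i.
    apply/seteqP; split => [omega [Comega Bomega] i /=|omega C'omega].
      rewrite ltnS leq_eqVlt /C' => /predU1P[->|ik]; first by rewrite eqxx.
      by rewrite lt_eqF//; exact: Comega.
    split=> [i /= ik|].
      by have := C'omega i; rewrite /= ltnS (ltnW ik) /C' lt_eqF//; exact.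
    by have := C'omega k; rewrite /= ltnSn /C' eqxx; exact.
  rewrite !cylE// -addn1 iotaD add0n big_cat big_seq1/= {2}/C' eqxx muleC.
  congr (_ * _)%E; apply: eq_big_seq => i /C'E ->//.
- by move=> _; rewrite -ge0_fin_numE// fin_num_measure.
Qed.

(** A one-step conditional estimate, stated without conditional expectations: as
    X_k is independent of the past, integrating psi over X_k first, with the
    past frozen at omega, amounts to integrating against the exponential
    density. *)
Lemma integral_next_le k (psi : Omega * R -> R) (phi : Omega -> R) :
  (forall B, measurable B ->
    distribution P (X k) B = exponential_prob 1 B) ->
  measurable_fun [set: past k * R] psi -> (forall t, 0 <= psi t) ->
  measurable_fun [set: past k] phi ->
  (forall omega, \int[lebesgue_measure]_s
     (psi (omega, s) * exponential_pdf 1 s)%:E <= (phi omega)%:E)%E ->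
  (\int[P]_omega (psi (omega, X k omega))%:E
    <= \int[P]_omega (phi omega)%:E)%E.
Proof.
move=> lawX mpsi psi0 mphi psi_phi.
have mid : measurable_fun [set: Omega] (id : Omega -> past k).
  by apply: (@measurable_past_forget k) => _ A mA; rewrite setTI.
pose Y : {mfun Omega >-> past k} :=
  HB.pack (id : Omega -> past k) (isMeasurableFun.Build _ _ _ _ _ mid).
(* Lebesgue measure lives on [measurableTypeR R], so X k is retyped. *)
have mX : measurable_fun [set: Omega] (X k : Omega -> measurableTypeR R).
  by move=> _ A mA; rewrite setTI; exact: (measurable_funPTI (X k)).
pose X' : {mfun Omega >-> measurableTypeR R} :=
  HB.pack (X k : Omega -> measurableTypeR R)
    (isMeasurableFun.Build _ _ _ _ _ mX).
have mpsiE : measurable_fun [set: past k * measurableTypeR R] (EFin \o psi).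
  exact/measurable_EFinP.
rewrite (integral_independent_pair (P := P) (Y := Y) (X := X') _ mpsiE);
  last 2 first.
- by move=> A B mA mB; exact: past_independent.
- by move=> t; rewrite lee_fin.
have phi0 omega : (0 <= (phi omega)%:E)%E.
  apply: le_trans (psi_phi omega); apply: integral_ge0 => s _.
  by rewrite lee_fin mulr_ge0// exponential_pdf_ge0.
rewrite -[leRHS]/(\int[P]_omega ((EFin \o phi) \o Y) omega)%E.
rewrite -(ge0_integral_distribution Y (f := EFin \o phi))//; last first.
  exact/measurable_EFinP.
apply: ge0_le_integral => //.
- by move=> y _; apply: integral_ge0 => x _; rewrite lee_fin.
- exact: (measurable_fun_fubini_tonelli_F (m2 := distribution P X')).
- exact/measurable_EFinP.
- move=> y _; apply: le_trans (psi_phi y); rewrite le_eqVlt.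
  apply/orP; left; apply/eqP.
  under [RHS]eq_integral do rewrite EFinM.
  apply: (@integral_density _ _ _ (distribution P X') lebesgue_measure
    (exponential_pdf 1) (fun s => (psi (y, s))%:E)).
  + exact: measurable_exponential_pdf.
  + exact: lawX.
  + by apply/measurable_EFinP; apply: measurableT_comp mpsi _.
  + by move=> x; rewrite lee_fin.
Qed.

End Past.

(** * Arrival times *)

(** (1 + t) exp (t^2/2 - t) is 1 at 0 and has derivative
    t^2 exp (t^2/2 - t). *)
Lemma expR_le_add1 {R : realType} (c : R) : 0 <= c ->
  expR (c - c ^+ 2 / 2) <= 1 + c.
Proof.
move=> c0.
pose phi := fun t : R => (1 + t) * expR (t ^+ 2 / 2 - t).
have dphi (t : R) : is_derive t 1 phi (t ^+ 2 * expR (t ^+ 2 / 2 - t)).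
  have did := is_derive_id t (1 : R).
  have dc := @is_derive_cst R R R.
  have dq : is_derive t 1 (fun t => t ^+ 2 / 2 - t) (t - 1).
    apply: (is_derive_congr
      (is_deriveB (is_deriveM (is_deriveM did did) (dc 2^-1 t 1)) did)).
      by move=> s; rewrite !fctE; ring.
    by rewrite !fctE /GRing.scale/=; field.
  apply: (is_derive_congr (is_deriveM (is_deriveD (dc 1 t 1) did)
    (@is_derive1_comp _ expR _ t _ _ (is_derive_expR _) dq))) => //.
  by rewrite !fctE /GRing.scale/=; ring.
have dphi1 (t : R) : derivable phi t 1 by have [] := dphi t.
have : phi 0 <= phi c.
  apply: (@ger0_derive1_ndecr _ phi 0 c) => //.
    by move=> t _; rewrite derive1E; have [_ ->] := dphi t;
      rewrite mulr_ge0 ?sqr_ge0 ?expR_ge0.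
  exact: continuous_subspaceT (is_derive_continuous dphi).
rewrite /phi addr0 expr0n/= mul0r subr0 expR0 mulr1.
by rewrite -opprB expRN ler_pdivlMr ?expR_gt0// mul1r.
Qed.

Section ArrivalTimes.
Context {R : realType} {dO} {Omega : measurableType dO}.
Context (P : probability Omega R) (T : nat -> {RV P >-> R}).
Hypothesis T_times : exponential_times T.

Lemma arrival_timeS k omega : T k.+1 omega = T k omega + increment T k omega.
Proof. by rewrite addrC subrK. Qed.

Lemma measurable_past_arrival k :
  measurable_fun [set: past (increment T) k] (T k).
Proof.
have [T0 _ _ _] := T_times.
elim: k => [|k IHk].
  by rewrite (_ : (T 0%N : Omega -> R) = cst 0)//; exact/funext.
rewrite (_ : (T k.+1 : Omega -> R)
  = (fun omega => T k omega + increment T k omega)); last first.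
  by apply/funext => omega; exact: arrival_timeS.
apply: measurable_funD; last exact: measurable_past_X.
exact: measurable_past_next.
Qed.

(** The Laplace transform of an exponential variable at c is 1 / (1 + c). *)
Lemma arrival_time_mgf c k : 0 < c ->
  (\int[P]_omega ((1 + c) ^+ k * expR (- c * T k omega))%:E <= 1)%E.
Proof.
move=> c0; have [T0 _ X_indep X_law] := T_times.
elim: k => [|k IHk].
  under eq_integral do rewrite T0 mulr0 expR0 mulr1 expr0.
  by rewrite integral_cst//= mul1e probability_setT.
apply: le_trans IHk.
pose psi (t : Omega * R) :=
  (1 + c) ^+ k.+1 * expR (- c * (T k t.1 + t.2)).
rewrite (eq_integral (fun omega => (psi (omega, increment T k omega))%:E));
  last by move=> omega _; rewrite /psi/= -arrival_timeS.
have pow_ge0 n : 0 <= (1 + c) ^+ n by rewrite exprn_ge0// addr_ge0// ltW.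
have mT := @measurable_past_arrival k.
apply: (integral_next_le X_indep) => //.
- exact: X_law.
- apply: measurable_funM => //; apply: (measurableT_comp (f := expR)) => //.
  apply: measurable_funM => //; apply: measurable_funD => //.
  exact: (measurableT_comp mT).
- by move=> t; rewrite mulr_ge0 ?expR_ge0.
- apply: measurable_funM => //; apply: (measurableT_comp (f := expR)) => //.
  exact: measurable_funM.
- move=> omega.
  have dH (s : R) : is_derive s 1
      (fun s => (1 + c) ^+ k * expR (- c * T k omega) * expR (- (1 + c) * s))
      (- (1 + c) * ((1 + c) ^+ k * expR (- c * T k omega)
        * expR (- (1 + c) * s))).
    apply: (is_derive_congr (is_deriveM (is_derive_cst
      ((1 + c) ^+ k * expR (- c * T k omega)) s 1)
      (is_derive_expRM (- (1 + c)) s))) => //.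
    by rewrite !fctE /GRing.scale/=; ring.
  have := exponential_integral_le dH (J := fun s => psi (omega, s)).
  rewrite mulr0 expR0 mulr1; apply.
  + move=> s; apply: cvgM; first exact: cvg_cst.
    apply: cvgM; first exact: cvg_cst.
    exact: (is_derive_continuous (is_derive_expRM (- (1 + c)))).
  + by move=> s; rewrite !mulr_ge0 ?expR_ge0 ?pow_ge0.
  + rewrite /psi/=; apply: measurable_funM => //.
    apply: (measurableT_comp (f := expR)) => //; apply: measurable_funM => //.
    by apply: (@measurable_funD _ _ _ _ (cst (T k omega)) id).
  + by move=> s; rewrite mulr_ge0 ?expR_ge0.
  + move=> s; rewrite le_eqVlt; apply/orP; left; apply/eqP.
    transitivity ((1 + c) ^+ k.+1
      * expR (- c * T k omega + - (1 + c) * s)).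
      by rewrite /psi/= -mulrA -expRD; congr (_ * expR _); ring.
    by rewrite expRD exprS; ring.
Qed.

(** Markov inequality for (1 + c)^k exp (- c T_k): on the event this variable
    exceeds exp (c^2 k / 2) because 1 + c >= exp (c - c^2 / 2), and
    exp y >= (1 + y / 2)^2 >= 2 y with y = c^2 k / 2.  The exponent - c is not
    the optimal - c / (1 - c), which is singular at c = 1, but it gives a bound
    of the same order. *)
Lemma arrival_time_lower_tail c k : (1 <= k)%N -> 0 < c ->
  (P [set omega | (T k omega < (1 - c) * k%:R)%R]
    <= (1 / (c ^+ 2 * k%:R))%:E)%E.
Proof.
move=> k1 c0; set C := expR (c ^+ 2 * k%:R / 2).
have k0 : 0 < k%:R :> R by rewrite ltr0n.
have mN : measurable_fun [set: Omega]
    (fun omega => (1 + c) ^+ k * expR (- c * T k omega)).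
  apply: measurable_funM => //; apply: (measurableT_comp (f := expR)) => //.
  exact: measurable_funM.
have N_ge0 omega : 0 <= (1 + c) ^+ k * expR (- c * T k omega).
  by rewrite mulr_ge0 ?expR_ge0// exprn_ge0// addr_ge0// ltW.
have := markov_bound mN N_ge0 ler01 (expR_gt0 (c ^+ 2 * k%:R / 2))
  (arrival_time_mgf k c0).
rewrite -/C mulr1 => PC.
apply: le_trans (le_trans PC _).
  apply: le_measure; rewrite ?inE.
  - exact: measurable_ltr_set.
  - exact: measurable_ltr_set.
  - move=> omega /= Tlt; rewrite /C.
    have -> : c ^+ 2 * k%:R / 2
        = (c - c ^+ 2 / 2) * k%:R + - c * ((1 - c) * k%:R) by field.
    rewrite expRD.
    apply: (@le_lt_trans _ _ ((1 + c) ^+ k * expR (- c * ((1 - c) * k%:R)))).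
      rewrite ler_wpM2r ?expR_ge0// expRM_natr.
      by rewrite lerXn2r ?nnegrE ?expR_ge0 ?addr_ge0 ?expR_le_add1 ?ltW.
    by rewrite ltr_pM2l ?exprn_gt0 ?addr_gt0// ltr_expR ltr_nM2l// oppr_lt0.
rewrite lee_fin div1r lef_pV2 ?posrE ?expR_gt0 ?mulr_gt0 ?exprn_gt0// /C.
have y_ge0 : 0 <= c ^+ 2 * k%:R / 2.
  by rewrite divr_ge0// mulr_ge0 ?sqr_ge0.
have c2kE : c ^+ 2 * k%:R = 2 * (c ^+ 2 * k%:R / 2) by field.
rewrite [leLHS]c2kE.
move: (c ^+ 2 * k%:R / 2) y_ge0 => y y_ge0.
have -> : expR y = expR (y / 2) ^+ 2.
  by rewrite -expRM_natr; congr expR; field.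
apply: (@le_trans _ _ ((1 + y / 2) ^+ 2)).
  by rewrite -subr_ge0 (_ : _ - _ = (1 - y / 2) ^+ 2) ?sqr_ge0//; field.
by rewrite lerXn2r ?nnegrE ?expR_ge0 ?expR_ge1Dx// addr_ge0// divr_ge0.
Qed.

End ArrivalTimes.

(** * The energy along the iterates *)

Section Convergence.
Context {R : realType} {d : nat}.
Context {f : 'rV[R]_d -> R} {wstar : 'rV[R]_d} {L rho mu : R}.
Hypotheses (L_gt0 : 0 < L) (rho_gt0 : 0 < rho) (mu_gt0 : 0 < mu).
Hypothesis f_diff : forall x : 'rV[R]_d, differentiable f x.
Hypothesis f_min : global_minimizer f wstar.
Hypothesis f_smooth : smooth L f.
Hypothesis f_sqc : strongly_quasar_convex rho mu f wstar.
Context {dO} {Omega : measurableType dO} {P : probability Omega R}.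
Context {T : nat -> {RV P >-> R}}.
Hypothesis T_times : exponential_times T.
Context {w0 z0 : 'rV[R]_d} {w z : nat -> Omega -> 'rV[R]_d}.
Hypotheses (w_init : forall omega, w 0%N omega = w0)
  (z_init : forall omega, z 0%N omega = z0).
Hypothesis w_step : forall k omega, w k.+1 omega
  = step_w f L rho mu (increment T k omega) (w k omega) (z k omega).
Hypothesis z_step : forall k omega, z k.+1 omega
  = step_z f L rho mu (increment T k omega) (w k omega) (z k omega).

Let a := rho * Num.sqrt (mu / L).
Local Notation Phi := (energy f wstar mu).

Lemma iterates_past_measurable k :
  coord_measurable (T := past (increment T) k) (w k)
  /\ coord_measurable (T := past (increment T) k) (z k).
Proof.
elim: k => [|k [mw mz]].
  rewrite (_ : w 0%N = fun=> w0); last exact/funext.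
  rewrite (_ : z 0%N = fun=> z0); last exact/funext.
  by split; exact: coord_measurable_cst.
have mw' : coord_measurable (T := past (increment T) k.+1) (w k).
  by move=> i; exact: measurable_past_next.
have mz' : coord_measurable (T := past (increment T) k.+1) (z k).
  by move=> i; exact: measurable_past_next.
have mX := @measurable_past_X _ _ _ P (increment T) k.
have wE : w k.+1 = fun omega =>
    step_w f L rho mu (increment T k omega) (w k omega) (z k omega).
  by apply/funext => omega.
have zE : z k.+1 = fun omega =>
    step_z f L rho mu (increment T k omega) (w k omega) (z k omega).
  by apply/funext => omega.
rewrite wE zE; split.
- exact: (coord_measurable_step_w rho mu f_diff f_smooth mX mw' mz').
- exact: (coord_measurable_step_z rho mu f_diff f_smooth mX mw' mz').
Qed.

(** The process exp (a T_k) Phi (w_k, z_k) is a supermartingale for the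
    filtration of the waiting times. *)
Lemma expected_energy_le k :
  (\int[P]_omega (expR (a * T k omega) * Phi (w k omega) (z k omega))%:E
    <= (Phi w0 z0)%:E)%E.
Proof.
have [T0 _ X_indep X_law] := T_times.
have Phi_ge0 := energy_ge0 mu_gt0 f_min.
elim: k => [|k IHk].
  under eq_integral do rewrite T0 mulr0 expR0 mul1r w_init z_init.
  by rewrite integral_cst//= probability_setT mule1.
apply: le_trans IHk.
have [mw mz] := iterates_past_measurable k.
have mT := @measurable_past_arrival _ _ _ P T T_times k.
pose psi (t : Omega * R) := expR (a * (T k t.1 + t.2))
  * Phi (step_w f L rho mu t.2 (w k t.1) (z k t.1))
        (step_z f L rho mu t.2 (w k t.1) (z k t.1)).
rewrite (eq_integral (fun omega => (psi (omega, increment T k omega))%:E));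
  last by move=> omega _; rewrite /psi/= -arrival_timeS w_step z_step.
apply: (integral_next_le X_indep) => //.
- exact: X_law.
- have mw1 : coord_measurable
      (T := (past (increment T) k * R)%type) (fun t => w k t.1).
    by move=> i; exact: (measurableT_comp (mw i)).
  have mz1 : coord_measurable
      (T := (past (increment T) k * R)%type) (fun t => z k t.1).
    by move=> i; exact: (measurableT_comp (mz i)).
  have ms : measurable_fun [set: past (increment T) k * R] snd by [].
  apply: measurable_funM.
    apply: (measurableT_comp (f := expR)) => //; apply: measurable_funM => //.
    apply: measurable_funD => //; exact: (measurableT_comp mT).
  apply: measurable_energy => //.
  + exact: (coord_measurable_step_w rho mu f_diff f_smooth ms mw1 mz1).
  + exact: (coord_measurable_step_z rho mu f_diff f_smooth ms mw1 mz1).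
- by move=> t; rewrite mulr_ge0 ?expR_ge0.
- apply: measurable_funM; last exact: measurable_energy.
  apply: (measurableT_comp (f := expR)) => //.
  exact: measurable_funM.
- move=> omega.
  set x := w k omega; set y := z k omega.
  have mstep : measurable_fun [set: R] (fun s => expR (a * s)
      * Phi (step_w f L rho mu s x y) (step_z f L rho mu s x y)
      * exponential_pdf 1 s).
    apply: measurable_funM; last exact: measurable_exponential_pdf.
    apply: measurable_funM.
      by apply: (measurableT_comp (f := expR)) => //; exact: measurable_funM.
    have mid := @measurable_id _ R [set: R].
    have mx := @coord_measurable_cst _ R R d x.
    have my := @coord_measurable_cst _ R R d y.
    apply: measurable_energy => //.
    + exact: (coord_measurable_step_w rho mu f_diff f_smooth mid mx my).
    + exact: (coord_measurable_step_z rho mu f_diff f_smooth mid mx my).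
  rewrite (eq_integral (fun s : measurableTypeR R =>
      (expR (a * T k omega))%:E * (expR (a * s)
      * Phi (step_w f L rho mu s x y) (step_z f L rho mu s x y)
      * exponential_pdf 1 s)%:E)%E); last first.
    move=> s _; rewrite -EFinM /psi/= [a * (_ + _)]mulrDr expRD.
    by rewrite !mulrA.
  rewrite ge0_integralZl//; last 2 first.
  + exact/measurable_EFinP.
  + move=> s _; rewrite lee_fin !mulr_ge0 ?expR_ge0//.
    exact: exponential_pdf_ge0.
  rewrite EFinM lee_pmul2l ?lte_fin ?expR_gt0//.
  exact: one_step_energy_le.
Qed.

Lemma iterate_objective_measurable k :
  measurable_fun [set: Omega] (fun omega => f (w k omega)).
Proof.
have [mw _] := iterates_past_measurable k.
apply: (measurable_past_forget (k := k) (X := increment T)).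
exact: measurable_objective.
Qed.

Lemma amplified_energy_measurable k : measurable_fun [set: Omega]
  (fun omega => expR (a * T k omega) * Phi (w k omega) (z k omega)).
Proof.
have [mw mz] := iterates_past_measurable k.
apply: measurable_funM; last first.
  apply: (measurable_past_forget (k := k) (X := increment T)).
  exact: measurable_energy.
by apply: (measurableT_comp (f := expR)) => //; exact: measurable_funM.
Qed.

Lemma amplified_energy_tail k c0 : 0 < c0 ->
  (P [set omega | (c0 * Phi w0 z0
       < expR (a * T k omega) * Phi (w k omega) (z k omega))%R]
     <= (1 / c0)%:E)%E.
Proof.
move=> c0_gt0; rewrite div1r.
have Phi_ge0 := energy_ge0 mu_gt0 f_min.
apply: markov_bound => //.
- exact: amplified_energy_measurable.
- by move=> omega; rewrite mulr_ge0 ?expR_ge0.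
- exact: expected_energy_le.
Qed.

End Convergence.

(** * Convergence with high probability *)

Unset Implicit Arguments.

Theorem corollary2 (R : realType) (d : nat)
    (f : 'rV[R]_d -> R) (wstar : 'rV[R]_d) (L rho mu : R)
    (L_gt0 : 0 < L) (rho_gt0 : 0 < rho) (mu_gt0 : 0 < mu)
    (f_diff : forall x : 'rV[R]_d, differentiable f x)
    (f_min : global_minimizer f wstar)
    (f_smooth : smooth L f)
    (f_sqc : strongly_quasar_convex rho mu f wstar)
    (dO : measure_display) (Omega : measurableType dO)
    (P : probability Omega R) (T : nat -> {RV P >-> R})
    (T_times : exponential_times T)
    (tau tau' : nat -> Omega -> R)
    (tauE : forall k omega, tau k omega =
      1 / (1 + rho) *
      (1 - expR (- (1 + rho) * Num.sqrt (mu / L)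
                 * (T k.+1 omega - T k omega))))
    (tau'E : forall k omega, tau' k omega =
      rho * (1 - expR (- (1 + rho) * Num.sqrt (mu / L)
                       * (T k.+1 omega - T k omega))) /
      (rho + expR (- (1 + rho) * Num.sqrt (mu / L)
                   * (T k.+1 omega - T k omega))))
    (w0 z0 : 'rV[R]_d) (v w z : nat -> Omega -> 'rV[R]_d)
    (w_init : forall omega, w 0%N omega = w0)
    (z_init : forall omega, z 0%N omega = z0)
    (wz_run : forall omega,
      algorithm f (tau ^~ omega) (tau' ^~ omega)
        (fun=> 1 / L) (fun=> 1 / Num.sqrt (mu * L))
        (v ^~ omega) (w ^~ omega) (z ^~ omega))
    (k : nat) (k_ge1 : (1 <= k)%N)
    (c : R) (c_gt0 : 0 < c) (c_lt1 : c < 1)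
    (c0 : R) (c0_gt1 : 1 < c0) :
  with_probability_at_least P (1 - 1 / (c ^+ 2 * k%:R) - 1 / c0)
    [set omega | f (w k omega) - f wstar <=
      c0 * (f w0 - f wstar + mu / 2 * enorm (z0 - wstar) ^+ 2)
      * expR (- rho * Num.sqrt (mu / L) * (1 - c) * k%:R)].
Proof.
have w_step n omega : w n.+1 omega
    = step_w f L rho mu (increment T n omega) (w n omega) (z n omega).
  have [vE -> _] := wz_run omega n.
  by rewrite (flow_wE (tauE n omega) vE).
have z_step n omega : z n.+1 omega
    = step_z f L rho mu (increment T n omega) (w n omega) (z n omega).
  have [vE _ ->] := wz_run omega n.
  by rewrite (flow_wE (tauE n omega) vE) (flow_zE _ _ _ (tau'E n omega)).
set a := rho * Num.sqrt (mu / L).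
set Phi0 := energy f wstar mu w0 z0.
set E := [set omega | _].
have EE : E = [set omega | f (w k omega) - f wstar
    <= c0 * Phi0 * expR (- a * ((1 - c) * k%:R))].
  rewrite /E /Phi0 /energy enorm_sq /a; congr mkset; apply/funext => omega.
  by rewrite -mulrA !mulNr !mulrA.
set A := [set omega | c0 * Phi0
  < expR (a * T k omega) * energy f wstar mu (w k omega) (z k omega)].
set B := [set omega | T k omega < (1 - c) * k%:R].
have PA : (P A <= (1 / c0)%:E)%E.
  exact: (amplified_energy_tail L_gt0 rho_gt0 mu_gt0 f_diff f_min f_smooth
    f_sqc T_times w_init z_init w_step z_step k
    (lt_trans ltr01 c0_gt1)).
have PB : (P B <= (1 / (c ^+ 2 * k%:R))%:E)%E.
  exact: (arrival_time_lower_tail T_times k_ge1 c_gt0).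
have mgap := iterate_objective_measurable f_diff f_smooth w_init z_init
  w_step z_step k.
have mA : measurable A.
  apply: measurable_ltr_set => //.
  exact: (amplified_energy_measurable f_diff f_smooth w_init
    z_init w_step z_step k).
have mB : measurable B by exact: measurable_ltr_set.
have mE : measurable E.
  rewrite EE -[X in measurable X]setCK; apply: measurableC.
  set bound := c0 * Phi0 * _.
  rewrite (_ : ~` _ = [set omega | bound < f (w k omega) - f wstar]).
    by apply: measurable_ltr_set => //; exact: measurable_funB.
  by apply/seteqP; split=> omega /=; rewrite ltNge => /negP.
have cover : [set: Omega] `<=` E `|` (A `|` B).
  move=> omega _; have [TB|BT] := ltP (T k omega) ((1 - c) * k%:R).
    by right; right.
  have [EA|AE] := ltP (c0 * Phi0)
    (expR (a * T k omega) * energy f wstar mu (w k omega) (z k omega)).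
    by right; left.
  left; rewrite EE /=.
  apply: (le_trans (gap_le_energy f wstar mu_gt0 _ (z k omega))).
  have Phi0_ge0 : 0 <= c0 * Phi0.
    rewrite mulr_ge0 ?(ltW (lt_trans ltr01 c0_gt1))//.
    exact: energy_ge0.
  apply: (@le_trans _ _ (c0 * Phi0 * expR (- a * T k omega))).
    by rewrite mulNr expRN ler_pdivlMr ?expR_gt0// mulrC.
  rewrite ler_wpM2l// ler_expR !mulNr lerN2 ler_wpM2l//.
  by rewrite mulr_ge0 ?sqrtr_ge0 ?ltW.
split=> //.
have P1 : (1 <= P E + (P A + P B))%E.
  rewrite -(probability_setT P).
  apply: (@le_trans _ _ (P (E `|` (A `|` B)))).
    by apply: le_measure; rewrite ?inE//; do 2 (apply: measurableU => //).
  apply: (le_trans (measureU2 _ _ _)) => //; first exact: measurableU.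
  by rewrite leeD2l// measureU2.
have {}P1 : (1 <= P E + ((1 / c0)%:E + (1 / (c ^+ 2 * k%:R))%:E))%E.
  by apply: le_trans P1 _; rewrite leeD2l// leeD.
have PEfin : P E \is a fin_num by exact: fin_num_measure.
move: P1; rewrite -(fineK PEfin) -!EFinD !lee_fin; lra.
Qed.
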